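(* Let $f_0:\mathbb{R}^n\to\overline{\mathbb{R}}$, $F:\mathbb{R}^n\to\mathbb{R}^m\cup\{+\infty_\bullet\}$ and $g:\mathbb{R}^m\to\overline{\mathbb{R}}$. For $y\in\mathbb{R}^m$ let $\langle y,F\rangle(x)=\langle y,F(x)\rangle$ if $x\in\operatorname{dom}(F)$ and $+\infty$ otherwise; let $(f_0+g\circ F)(x)=f_0(x)+g(F(x))$ if $x\in\operatorname{dom}(F)$ and $+\infty$ otherwise; let $f:\mathbb{R}^n\times\mathbb{R}^m\to\overline{\mathbb{R}}$ be given by $f(x,u)=f_0(x)+g(F(x)+u)$ if $x\in\operatorname{dom}(F)$ and $+\infty$ otherwise; and let $U=\operatorname{dom}(g)-F(\operatorname{dom}(f_0)\cap\operatorname{dom}(F))$ (equivalently $U=\{u\in\mathbb{R}^m:\inf_{x}f(x,u)<+\infty\}$). If $f\in\Gamma(\mathbb{R}^n\times\mathbb{R}^m)$, $f(x,u)$ is closed in $u$ (i.e. $f(x,\cdot)$ is closed for every $x\in\mathbb{R}^n$), and $\operatorname{dom}(F)\neq\emptyset$, then $f_0+g\circ F$ and $g$ are convex, $f_0+\langle\bar y,F\rangle$ is convex for every $\bar y\in\operatorname{dom}(g^* )$, and for all $\bar x\in\operatorname{dom}(f_0+g\circ F)$ $$\partial(f_0+g\circ F)(\bar x)\supseteq\bigcup_{\bar y\in\partial g(F(\bar x))}\partial(f_0+\langle\bar y,F\rangle)(\bar x).$$ In addition, this inclusion holds with equality if $f\in\Gamma_0(\mathbb{R}^n\times\mathbb{R}^m)$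 and either $0\in\operatorname{rint}(U)$, or $0\in U$ and $f$ is piecewise linear-quadratic.
   Context: $\overline{\mathbb{R}}=\mathbb{R}\cup\{-\infty,+\infty\}$; sums of opposite infinities follow the convention $(+\infty)+(-\infty)=+\infty$. For $h:\mathbb{R}^p\to\overline{\mathbb{R}}$: $\operatorname{dom}(h)=\{x:h(x)<+\infty\}$, $\operatorname{epi}(h)=\{(x,\alpha)\in\mathbb{R}^p\times\mathbb{R}:h(x)\le\alpha\}$, $h^*(v)=\sup_{x}\{\langle v,x\rangle-h(x)\}$. $h$ is convex (closed) if $\operatorname{epi}(h)$ is convex (closed), and proper if $h\not\equiv+\infty$ and $h>-\infty$ everywhere. $\Gamma(\mathbb{R}^p)$ is the set of proper convex functions $\mathbb{R}^p\to\overline{\mathbb{R}}$, and $\Gamma_0(\mathbb{R}^p)$ the set of closed functions in $\Gamma(\mathbb{R}^p)$. For convex $h$, $\partial h(\bar x)=\{v:h(x)\ge h(\bar x)+\langle v,x-\bar x\rangle\ \forall x\}$ if $h(\bar x)\in\mathbb{R}$, and $\partial h(\bar x)=\emptyset$ otherwise. $\operatorname{rint}$ denotes relative interior. $+\infty_\bullet$ is an extra ''infinite element'' adjoined to $\mathbb{R}^m$; for $F:\mathbb{R}^n\to\mathbb{R}^m\cup\{+\infty_\bullet\}$, $\operatorname{dom}(F)=\{x:F(x)\neq+\infty_\bullet\}$. A function $h:\mathbb{R}^p\to\mathbb{R}\cup\{+\infty\}$ is piecewise linear-quadratic if there are a finite index set $I$ and, for each $i\in I$, a polyhedron $P_i\subseteq\mathbb{R}^p$,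 $A^i\in\mathbb{R}^{p\times p}$, $q^i\in\mathbb{R}^p$, $u_i\in\mathbb{R}$ such that $h(x)=\frac12\langle x,A^ix\rangle+\langle q^i,x\rangle-u_i$ for $x\in P_i$, $i\in I$, and $h(x)=+\infty$ for $x\notin\bigcup_{i\in I}P_i$. *)

(* Defs.v *)
From HB Require Import structures.
From mathcomp Require Import all_boot all_order all_algebra.
From mathcomp Require Import all_classical all_reals all_analysis.

Set Implicit Arguments.
Unset Strict Implicit.
Unset Printing Implicit Defensive.

Import Order.TTheory GRing.Theory Num.Theory.
Import numFieldNormedType.Exports.

Local Open Scope classical_set_scope.
Local Open Scope ring_scope.

(* R^p is 'rV[R]_p, and R^n x R^m is identified with 'rV[R]_(n + m).          *)
(* The sum (+oo) + (-oo) = +oo is the dual addition of \bar R, written        *)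
(* (x + y)%dE; the plain %E addition is used only when one term is finite.    *)

Section convex_analysis.
Context {R : realType} {p : nat}.
Implicit Types (x v : 'rV[R]_p) (h : 'rV[R]_p -> \bar R) (C : set 'rV[R]_p).

Definition dot x v : R := \sum_(i < p) x 0 i * v 0 i.

Definition edom h : set 'rV[R]_p := [set x | (h x < +oo)%E].

Definition epi h : set ('rV[R]_p * R^o) :=
  [set z | (h z.1 <= (z.2 : R)%:E)%E].

Definition conjugate h v : \bar R :=
  ereal_sup [set ((dot v x)%:E - h x)%E | x in [set: 'rV[R]_p]].

Definition convex_fun h : Prop := convex_set (epi h).

Definition closed_fun h : Prop := closed (epi h).

Definition proper_fun h : Prop :=
  (exists x, h x <> +oo%E) /\ (forall x, (-oo < h x)%E).

Definition Gamma h : Prop := proper_fun h /\ convex_fun h.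

Definition Gamma0 h : Prop := Gamma h /\ closed_fun h.

Definition subdiff h (xb : 'rV[R]_p) : set 'rV[R]_p :=
  [set v | h xb \is a fin_num /\
           forall x, (h x >= h xb + (dot v (x - xb))%:E)%E].

Definition affine_set C : Prop :=
  forall x v (t : R), C x -> C v -> C ((1 - t) *: x + t *: v).

Definition affine_hull C : set 'rV[R]_p := smallest affine_set C.

Definition rint C : set 'rV[R]_p :=
  [set x | affine_hull C x /\ \forall y \near x, affine_hull C y -> C y].

Definition polyhedron C : Prop :=
  exists (k : nat) (a : 'I_k -> 'rV[R]_p) (b : 'I_k -> R),
    C = [set x | forall j, dot (a j) x <= b j].

(* In row-vector notation the vector A x is x *m A^T. *)
Definition piecewise_linear_quadratic h : Prop :=
  exists (I : finType) (P : I -> set 'rV[R]_p) (A : I -> 'M[R]_p)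
         (q : I -> 'rV[R]_p) (u : I -> R),
    [/\ forall i, polyhedron (P i),
        forall i x, P i x ->
          h x = (2^-1 * dot x (x *m (A i)^T) + dot (q i) x - u i)%:E
      & forall x, ~ (\bigcup_i P i) x -> h x = +oo%E].

End convex_analysis.

(* A map R^n -> R^m with an adjoined infinite element is option-valued, the   *)
(* infinite element being None.                                               *)
Section composite.
Context {R : realType} {n m : nat}.
Implicit Types (F : 'rV[R]_n -> option 'rV[R]_m) (g : 'rV[R]_m -> \bar R).

Definition odom F : set 'rV[R]_n := [set x | F x <> None].

Definition oimage F (A : set 'rV[R]_n) : set 'rV[R]_m :=
  [set w | exists2 x, A x & F x = Some w].

Definition scalarization (y : 'rV[R]_m) F (x : 'rV[R]_n) : \bar R :=
  if F x is Some w then (dot y w)%:E else +oo%E.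

(* f_0 + <y, F> *)
Definition lagrangian (f0 : 'rV[R]_n -> \bar R) F
    (y : 'rV[R]_m) (x : 'rV[R]_n) : \bar R :=
  (f0 x + scalarization y F x)%dE.

(* f_0 + g o F *)
Definition composite (f0 : 'rV[R]_n -> \bar R) F g
    (x : 'rV[R]_n) : \bar R :=
  if F x is Some w then (f0 x + g w)%dE else +oo%E.

Definition perturbation (f0 : 'rV[R]_n -> \bar R) F g
    (x : 'rV[R]_n) (u : 'rV[R]_m) : \bar R :=
  if F x is Some w then (f0 x + g (w + u)%R)%dE else +oo%E.

Definition joint (f : 'rV[R]_n -> 'rV[R]_m -> \bar R) (z : 'rV[R]_(n + m)) :
  \bar R := f (lsubmx z) (rsubmx z).

Definition shift_set (f0 : 'rV[R]_n -> \bar R) F g : set 'rV[R]_m :=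
  [set v - w | v in edom g & w in oimage F (edom f0 `&` odom F)].

Lemma shift_setE (f0 : 'rV[R]_n -> \bar R) F g :
  shift_set f0 F g =
  [set u | (ereal_inf [set perturbation f0 F g x u | x in setT] < +oo)%E].
Proof.
have addlt (a b : \bar R) : (a + b < +oo)%dE <-> (a < +oo /\ b < +oo)%E.
  by split; case: a b => [a| |] [b| |] //=; rewrite ?ltry ?ltNyr //; case.
apply/seteqP; split => u /=.
- move=> [v gv [w [x [f0x _] Fx] <-]].
  apply: (@le_lt_trans _ _ (perturbation f0 F g x (v - w))).
    by apply: ereal_inf_lbound; exists x.
  by rewrite /perturbation Fx [w + _]addrC subrK; apply/addlt.
- move=> /ereal_inf_lt[_ [x _ <-]]; rewrite /perturbation.
  case Fx: (F x) => [w|]; last by rewrite ltxx.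
  move=> /addlt[f0x gx]; exists (w + u) => //.
  exists w; last by rewrite addrC addKr.
  by exists x => //; split => //; rewrite /odom/= Fx.
Qed.

End composite.

(* Main.v *)
(* Write c for the finite value of f_0 + g o F at xb.  Given v in its         *)
(* subdifferential, it suffices to find y such that                           *)
(*   c + <v, x - xb> + <y, u> <= f(x, u) for all x, u:                        *)
(* taking x = xb shows that y is a subgradient of g at F(xb), and taking      *)
(* u = F(xb) - F(x) shows that v is a subgradient of f_0 + <y, F> at xb.      *)
(* Under the relative interior condition, y is built one coordinate at a      *)
(* time as in the Hahn-Banach theorem; in the piecewise linear-quadratic      *)
(* case, the condition on y bears only on finitely many directions, namely    *)
(* generators of the tangent cones at (xb, 0) of the pieces, and y comes from *)
(* Farkas' lemma.                                                             *)
Require Import Defs.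
From HB Require Import structures.
From mathcomp Require Import all_boot all_order all_algebra.
From mathcomp Require Import all_classical all_reals all_analysis.
From mathcomp Require Import ring lra.

Set Implicit Arguments.
Unset Strict Implicit.
Unset Printing Implicit Defensive.

Import Order.TTheory GRing.Theory Num.Theory.
Import numFieldNormedType.Exports.

Local Open Scope classical_set_scope.
Local Open Scope ring_scope.

(** Convexity is inherited from [f]: [f_0 + g o F] is its slice at [u = 0], [g] is, up to a
    translation and an additive constant, a slice at a fixed [x], and the Lagrangian is, up to a
    constant, a partial minimization. The inclusion comes from adding two subgradient inequalities,
    in which the terms [<y, F>] cancel ([composite_subdiff_sup]).

    For equality, a subgradient [v] of the slice [f(., 0)] must be completed to a subgradient
    [(v, y)] of [f] at [(xb, 0)]. Equivalently, [y] is a linear minorant of the convex function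
    [phi(u) = inf_x (f(x, u) - c - <v, x - xb>)], and the choice of [v] says that [phi(0) >= 0]. If
    0 is relatively interior to the domain [U] of [phi], Hahn-Banach applies ([convex_minorant],
    [partial_subgradient_relint]). If [f] is piecewise linear-quadratic, Farkas' lemma bounds its
    directional derivatives on finitely many generators, and convexity passes from derivatives to
    values ([cone_generators], [cone_minorant], [partial_subgradient_plq]). *)

Section dot_theory.
Context {R : realType} {p : nat}.
Implicit Types x y v : 'rV[R]_p.

(** * Bilinearity of the dot product *)

Lemma dotC x v : dot x v = dot v x.
Proof. by apply: eq_bigr => i _; rewrite mulrC. Qed.

Lemma dotDr v x y : dot v (x + y) = dot v x + dot v y.
Proof. by rewrite -big_split; apply: eq_bigr => i _; rewrite mxE mulrDr. Qed.

Lemma dotZr v (t : R) x : dot v (t *: x) = t * dot v x.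
Proof. by rewrite mulr_sumr; apply: eq_bigr => i _; rewrite mxE mulrCA. Qed.

Lemma dotNr v x : dot v (- x) = - dot v x.
Proof. by rewrite -scaleN1r dotZr mulN1r. Qed.

Lemma dotBr v x y : dot v (x - y) = dot v x - dot v y.
Proof. by rewrite dotDr dotNr. Qed.

Lemma dot0r v : dot v 0 = 0.
Proof. by rewrite -(scale0r v) dotZr mul0r. Qed.

Lemma dotDl v x y : dot (x + y) v = dot x v + dot y v.
Proof. by rewrite dotC dotDr !(dotC v). Qed.

Lemma dotZl v (t : R) x : dot (t *: x) v = t * dot x v.
Proof. by rewrite dotC dotZr (dotC v). Qed.

Lemma dotNl v x : dot (- x) v = - dot x v.
Proof. by rewrite dotC dotNr (dotC v). Qed.

Lemma dotBl v x y : dot (x - y) v = dot x v - dot y v.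
Proof. by rewrite dotDl dotNl. Qed.

Lemma dot0l v : dot 0 v = 0.
Proof. by rewrite dotC dot0r. Qed.

Lemma dot_delta (i : 'I_p) v : dot (delta_mx 0 i) v = v 0 i.
Proof.
rewrite /dot (bigD1 i)//= mxE !eqxx mul1r big1 ?addr0// => j ji.
by rewrite mxE (negbTE ji) andbF mul0r.
Qed.

End dot_theory.

Lemma dot_row_mx (R : realType) (n m : nat) (a : 'rV[R]_n) (b : 'rV[R]_m)
    (z : 'rV[R]_(n + m)) :
  dot (row_mx a b) z = dot a (lsubmx z) + dot b (rsubmx z).
Proof.
rewrite /dot big_split_ord/=; congr (_ + _); apply: eq_bigr => i _.
  by rewrite row_mxEl mxE.
by rewrite row_mxEr mxE.
Qed.

(** Real upper bounds [a], [b] in place of the values of [h] keep infinite sums out of the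
    inequality. *)
Lemma convex_funP (R : realType) (p : nat) (h : 'rV[R]_p -> \bar R) :
  convex_fun h <->
  forall x y (a b t : R), 0 <= t <= 1 -> (h x <= a%:E)%E -> (h y <= b%:E)%E ->
    (h (t *: x + (1 - t) *: y)%R <= (t * a + (1 - t) * b)%:E)%E.
Proof.
split=> [hc x y a b t t01 hx hy|hc [x a] [y b] t].
- have := hc (x, a) (y, b) (Itv01 (andP t01).1 (andP t01).2).
  by rewrite !inE => /(_ hx hy).
- rewrite !inE /epi/= => hx hy; apply: hc => //.
  by rewrite ge0 le1.
Qed.

(** * Separation and bounds of sets of reals *)

Section real_bounds.
Context {R : realType}.

Lemma exists_between (A B : set R) :
  (forall a b, A a -> B b -> a <= b) ->
  (exists u, forall a, A a -> a <= u) -> (exists l, forall b, B b -> l <= b) ->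
  exists c, (forall a, A a -> a <= c) /\ (forall b, B b -> c <= b).
Proof.
move=> AB [u Au] [l Bl].
have [A0|A0] := pselect (A !=set0); last first.
  (* For empty [A] the supremum carries no information, so the lower bound of [B] serves. *)
  exists l; split => // a Aa; exfalso; apply: A0; by exists a.
exists (sup A); split => [a Aa|b Bb].
  by apply: ub_le_sup => //; exists u => x /Au.
by apply: ge_sup => // a /AB; apply.
Qed.

Lemma seq_ubound (T : eqType) (s : seq T) (phi : T -> R) :
  exists u, forall z, z \in s -> phi z <= u.
Proof.
elim: s => [|z s [u su]]; first by exists 0.
exists (Num.max (phi z) u) => x; rewrite in_cons => /predU1P[->|/su xu].
  by rewrite le_max lexx.
by rewrite le_max xu orbT.
Qed.

Lemma seq_lbound (T : eqType) (s : seq T) (phi : T -> R) :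
  exists l, forall z, z \in s -> l <= phi z.
Proof.
have [u su] := seq_ubound s (fun z => - phi z).
by exists (- u) => z /su; rewrite lerNl.
Qed.

End real_bounds.

(** * Linear minorants: Hahn-Banach and Farkas by elimination of coordinates *)

Section linear_minorants.
Context {R : realType} {m : nat}.
Implicit Types (D C : set ('rV[R]_m * R)) (y u : 'rV[R]_m).

(** The positive combination of [z] and [z'] that kills coordinate [i] satisfies the bound exactly
    when the two difference quotients are ordered. *)
Lemma quotient_le (i : 'I_m) y (z z' : 'rV[R]_m * R) :
  0 < z.1 0 i -> z'.1 0 i < 0 ->
  dot y (z.1 0 i *: z'.1 - z'.1 0 i *: z.1) <=
    z.1 0 i * z'.2 - z'.1 0 i * z.2 ->
  (z'.2 - dot y z'.1) / z'.1 0 i <= (z.2 - dot y z.1) / z.1 0 i.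
Proof.
move=> z0 z'0; rewrite dotBr !dotZr => H.
by rewrite ler_pdivlMr// mulrAC ler_ndivrMr//; nra.
Qed.

(* One step of Hahn-Banach, equivalently of Fourier-Motzkin elimination: the  *)
(* new slope c separates the difference quotients of the two half-spaces.     *)
Lemma extend_minorant D (i : 'I_m) y :
  (forall z, D z -> z.1 0 i = 0 -> dot y z.1 <= z.2) ->
  (forall z z', D z -> D z' -> 0 < z.1 0 i -> z'.1 0 i < 0 ->
    dot y (z.1 0 i *: z'.1 - z'.1 0 i *: z.1) <=
    z.1 0 i * z'.2 - z'.1 0 i * z.2) ->
  (exists b, forall z, D z -> z.1 0 i < 0 ->
     (z.2 - dot y z.1) / z.1 0 i <= b) ->
  (exists b, forall z, D z -> 0 < z.1 0 i ->
     b <= (z.2 - dot y z.1) / z.1 0 i) ->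
  exists c, forall z, D z -> dot (y + c *: delta_mx 0 i) z.1 <= z.2.
Proof.
move=> y0 yC [b bD] [b' bD'].
pose q (z : 'rV[R]_m * R) := (z.2 - dot y z.1) / z.1 0 i.
have [|||c [cA cB]] := @exists_between R
    [set q z | z in [set z | D z /\ z.1 0 i < 0]]
    [set q z | z in [set z | D z /\ 0 < z.1 0 i]].
- move=> _ _ [z' [Dz' z'0] <-] [z [Dz z0] <-].
  by apply: quotient_le => //; exact: yC.
- by exists b => _ [z [Dz z0] <-]; exact: bD.
- by exists b' => _ [z [Dz z0] <-]; exact: bD'.
exists c => z Dz; rewrite dotDl dotZl dot_delta.
have [z0|z0|z0] := ltgtP (z.1 0 i) 0.
- have /cA : [set q z | z in [set z | D z /\ z.1 0 i < 0]] (q z) by exists z.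
  by rewrite /q ler_ndivrMr//; lra.
- have /cB : [set q z | z in [set z | D z /\ 0 < z.1 0 i]] (q z) by exists z.
  by rewrite /q ler_pdivlMr//; lra.
- by rewrite z0 mulr0 addr0 y0.
Qed.

(** Finite-dimensional Hahn-Banach for an epigraph-like [E]. The last hypothesis says that the
    projection of [E] contains a point opposite to each of its points; it rules out vertical slopes.
    The induction lets one more coordinate be nonzero at each step. *)
Lemma convex_minorant (E : set ('rV[R]_m * R)) :
  (forall z z' t, 0 <= t <= 1 -> E z -> E z' ->
     E (t *: z.1 + (1 - t) *: z'.1, t * z.2 + (1 - t) * z'.2)) ->
  (forall a, E (0, a) -> 0 <= a) ->
  (forall z, E z -> exists t b, 0 < t /\ E (- t *: z.1, b)) ->
  exists y, forall z, E z -> dot y z.1 <= z.2.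
Proof.
move=> Ec E0 En.
suff {}H k : exists y, forall z, E z ->
    (forall j : 'I_m, (k <= j)%N -> z.1 0 j = 0) -> dot y z.1 <= z.2.
  have [y Hy] := H m; exists y => z Ez; apply: Hy => // j.
  by rewrite leqNgt ltn_ord.
elim: k => [|k [y Hy]].
  exists 0 => -[u a] Eu u0; rewrite dot0l; apply: E0.
  suff <- : u = 0 by [].
  by apply/rowP => j; rewrite mxE u0.
have [km|mk] := ltnP k m; last first.
  exists y => z Ez z0; apply: Hy => // j kj.
  by have := leq_trans mk kj; rewrite leqNgt ltn_ord.
pose i := Ordinal km.
pose D := [set z | E z /\ forall j : 'I_m, (k < j)%N -> z.1 0 j = 0].
have Dcomb z z' : D z -> D z' -> 0 < z.1 0 i -> z'.1 0 i < 0 ->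
    dot y (z.1 0 i *: z'.1 - z'.1 0 i *: z.1) <=
    z.1 0 i * z'.2 - z'.1 0 i * z.2.
  move=> [Ez z0] [Ez' z'0] s0 s'0.
  set s := z.1 0 i in s0 *; set s' := z'.1 0 i in s'0 *.
  have r0 : 0 < s - s' by rewrite subr_gt0 (lt_trans s'0).
  (* The convex weights for which coordinate [i] of the combination vanishes, so that [y] already
     applies to it. *)
  have t01 : 0 <= - s' / (s - s') <= 1.
    by rewrite ler_pdivrMr// ler_pdivlMr//; lra.
  have r1 : 1 - - s' / (s - s') = s / (s - s') by field; rewrite gt_eqF.
  have := Hy _ (Ec _ _ _ t01 Ez Ez').
  rewrite r1 /= => H.
  have {}H : dot y ((s - s')^-1 *: (s *: z'.1 - s' *: z.1)) <=
             (s - s')^-1 * (s * z'.2 - s' * z.2).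
    have e1 : (s - s')^-1 *: (s *: z'.1 - s' *: z.1) =
      (- s' / (s - s')) *: z.1 + (s / (s - s')) *: z'.1.
      rewrite scalerBr !scalerA addrC -scaleNr; congr (_ *: _ + _ *: _); ring.
    have e2 : (s - s')^-1 * (s * z'.2 - s' * z.2) =
      - s' / (s - s') * z.2 + s / (s - s') * z'.2 by ring.
    rewrite e1 e2; apply: H => j kj; rewrite !mxE.
    move: kj; rewrite leq_eqVlt => /predU1P[kj|kj]; last first.
      by rewrite z0// z'0// !mulr0 addr0.
    have -> : j = i by apply: val_inj.
    by rewrite -/s -/s'; ring.
  by move: H; rewrite dotZr ler_pM2l// invr_gt0.
have Dn z : D z -> exists z', [/\ D z', (0 < z.1 0 i -> z'.1 0 i < 0) &
    (z.1 0 i < 0 -> 0 < z'.1 0 i)].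
  move=> [/En[t [b [t0 Et]]] z0]; exists (- t *: z.1, b); split => /=.
  - by split => // j kj /=; rewrite !mxE z0// mulr0.
  - by rewrite !mxE => ?; rewrite mulNr oppr_lt0 mulr_gt0.
  - by rewrite !mxE => ?; rewrite mulNr oppr_gt0 pmulr_rlt0.
have key z z' : D z -> D z' -> 0 < z.1 0 i -> z'.1 0 i < 0 ->
    (z'.2 - dot y z'.1) / z'.1 0 i <= (z.2 - dot y z.1) / z.1 0 i.
  by move=> Dz Dz' z0 z'0; apply: quotient_le => //; exact: Dcomb.
have [||||c Hc] := @extend_minorant D i y.
- move=> z [Ez z0] zi; apply: Hy => // j.
  rewrite leq_eqVlt => /predU1P[kj|/z0//].
  by rewrite -zi; congr (z.1 0 _); apply: val_inj.
- exact: Dcomb.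
(* A point on one side bounds all quotients on the other. If one side is empty, [Dn] makes the other
   empty too, and the bound 0 is vacuous. *)
- have [[z [Dz zi]]|no] := pselect (exists z, D z /\ 0 < z.1 0 i).
    by exists ((z.2 - dot y z.1) / z.1 0 i) => z' Dz' z'i; exact: key.
  exists 0 => z' /Dn[z [Dz _ H]] /H zi; exfalso; apply: no; by exists z.
- have [[z [Dz zi]]|no] := pselect (exists z, D z /\ z.1 0 i < 0).
    by exists ((z.2 - dot y z.1) / z.1 0 i) => z' Dz' z'i; exact: key.
  exists 0 => z' /Dn[z [Dz H _]] /H zi; exfalso; apply: no; by exists z.
by exists (y + c *: delta_mx 0 i) => z Ez z0; apply: Hc.
Qed.

(* Farkas' lemma; C stands for the cone generated by S but may be larger,     *)
(* so that no coefficients appear.                                            *)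
Lemma cone_minorant C (S : seq ('rV[R]_m * R)) :
  (forall z z', C z -> C z' -> C (z.1 + z'.1, z.2 + z'.2)) ->
  (forall (t : R) z, 0 < t -> C z -> C (t *: z.1, t * z.2)) ->
  (forall a, C (0, a) -> 0 <= a) ->
  (forall z, z \in S -> C z) ->
  exists y, forall z, z \in S -> dot y z.1 <= z.2.
Proof.
move=> CD CZ C0.
suff {S}H k (S : seq ('rV[R]_m * R)) : (forall z, z \in S -> C z /\
      forall j : 'I_m, (k <= j)%N -> z.1 0 j = 0) ->
    exists y, forall z, z \in S -> dot y z.1 <= z.2.
  move=> SC; apply: (H m) => z /SC Cz; split => // j.
  by rewrite leqNgt ltn_ord.
elim: k S => [|k IH] S SC.
  exists 0 => -[u a] /SC[Cu u0]; rewrite dot0l; apply: C0.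
  suff <- : u = 0 by [].
  by apply/rowP => j; rewrite mxE u0.
have [km|mk] := ltnP k m; last first.
  apply: IH => z /SC[Cz z0]; split => // j kj.
  by have := leq_trans mk kj; rewrite leqNgt ltn_ord.
pose i := Ordinal km.
pose comb (z z' : 'rV[R]_m * R) :=
  (z.1 0 i *: z'.1 - z'.1 0 i *: z.1, z.1 0 i * z'.2 - z'.1 0 i * z.2).
pose coord (z : 'rV[R]_m * R) : R := z.1 0 i.
(* Fourier-Motzkin: keep the elements with zero coordinate and combine each pair of opposite
   signs. *)
pose S' := [seq z <- S | coord z == 0] ++
  [seq comb z z' | z <- [seq z <- S | 0 < coord z],
                   z' <- [seq z <- S | coord z < 0]].
have [z|y Hy] := IH S'.
  rewrite mem_cat => /orP[|/allpairsP[[z1 z2]/= []]].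
    rewrite mem_filter => /andP[/eqP zi /SC[Cz z0]]; split => // j.
    rewrite leq_eqVlt => /predU1P[kj|/z0//].
    by rewrite -zi; congr (z.1 0 _); apply: val_inj.
  rewrite !mem_filter => /andP[z1i /SC[Cz1 z10]] /andP[z2i /SC[Cz2 z20]] ->.
  split.
    rewrite /comb addrC -scaleNr [X in (_, X)]addrC -mulNr.
    apply: (CD (_, _) (_, _)); apply: CZ => //; by rewrite oppr_gt0.
  move=> j; rewrite leq_eqVlt => /predU1P[kj|kj]; rewrite !mxE.
    have -> : j = i by apply: val_inj.
    by ring.
  by rewrite (z10 j)// (z20 j)// !mulr0 subr0.
have [||||c Hc] := @extend_minorant [set` S] i y.
- move=> z zS zi; apply: Hy.
  by rewrite mem_cat mem_filter /coord zi eqxx zS.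
- move=> z z' zS z'S zi z'i; apply: (Hy (comb z z')).
  rewrite mem_cat; apply/orP; right; apply/allpairsP; exists (z, z') => /=.
  by rewrite !mem_filter /coord zi z'i.
(* Finiteness of [S] supplies the bounds that opposite points supply in [convex_minorant]. *)
- have [b Hb] := seq_ubound S (fun z => (z.2 - dot y z.1) / z.1 0 i).
  by exists b => z /Hb.
- have [b Hb] := seq_lbound S (fun z => (z.2 - dot y z.1) / z.1 0 i).
  by exists b => z /Hb.
by exists (y + c *: delta_mx 0 i) => z zS; apply: Hc.
Qed.

End linear_minorants.

(* The Minkowski-Weyl theorem by the double description method; that G        *)
(* generates the cone is expressed dually, through linear functionals.        *)
Lemma cone_generators (R : realType) (p : nat) (s : seq 'rV[R]_p) :
  exists G : seq 'rV[R]_p,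
    (forall w, w \in G -> forall a, a \in s -> dot a w <= 0) /\
    forall l, (forall w, w \in G -> 0 <= dot l w) ->
      forall w, (forall a, a \in s -> dot a w <= 0) -> 0 <= dot l w.
Proof.
elim: s => [|a s [G [Gs HG]]].
  exists ([seq delta_mx 0 i | i <- enum 'I_p] ++
          [seq - delta_mx 0 i | i <- enum 'I_p]); split => // l Hl w _.
  rewrite [dot l w]big1// => i _.
  have /Hl : delta_mx 0 i \in [seq delta_mx 0 i | i <- enum 'I_p] ++
          [seq - (delta_mx 0 i : 'rV[R]_p) | i <- enum 'I_p].
    by rewrite mem_cat map_f ?mem_enum.
  have /Hl : - delta_mx 0 i \in [seq delta_mx 0 i | i <- enum 'I_p] ++
          [seq - (delta_mx 0 i : 'rV[R]_p) | i <- enum 'I_p].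
    by rewrite mem_cat orbC (map_f (fun i => - delta_mx 0 i)) ?mem_enum.
  rewrite dotNr dotC dot_delta oppr_ge0 => l1 l2.
  by rewrite (@le_anti _ _ (l 0 i) 0) ?mul0r// l1.
(* Generators that satisfy the new constraint are kept; each pair on opposite sides is combined into
   a vector of the hyperplane [dot a w = 0]. *)
pose G' := [seq w <- G | dot a w <= 0] ++
  [seq dot a w *: w' - dot a w' *: w | w <- [seq w <- G | 0 < dot a w],
                                       w' <- [seq w <- G | dot a w < 0]].
exists G'; split => [w|l Hl w Hw].
  rewrite mem_cat => /orP[|/allpairsP[[w1 w2]/= []]].
    rewrite mem_filter => /andP[aw wG] b; rewrite in_cons => /predU1P[->//|].
    exact: Gs.
  rewrite !mem_filter => /andP[w1a w1G] /andP[w2a w2G] -> b.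
  rewrite dotBr !dotZr in_cons => /predU1P[->|bs].
    by rewrite mulrC subrr.
  by have := Gs _ w1G _ bs; have := Gs _ w2G _ bs; nra.
have Hl0 w' : w' \in G -> dot a w' <= 0 -> 0 <= dot l w'.
  by move=> wG aw; apply: Hl; rewrite mem_cat mem_filter aw wG.
have Hl1 w1 w2 : w1 \in G -> w2 \in G -> 0 < dot a w1 -> dot a w2 < 0 ->
    0 <= dot a w1 * dot l w2 - dot a w2 * dot l w1.
  move=> w1G w2G a1 a2; rewrite -!dotZr -dotBr; apply: Hl.
  rewrite mem_cat; apply/orP; right; apply/allpairsP; exists (w1, w2) => /=.
  by rewrite !mem_filter a1 a2.
(* [l + c *: a] is nonnegative at [w] when [c] is above [q w] if [dot a w] is positive, below it if
   negative. Adding 0 to the lower set forces [0 <= c], so [l] dominates [l + c *: a] where [a] is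
   nonpositive. *)
pose q w := - dot l w / dot a w.
have [|||c [cA cB]] := @exists_between R
    [set r | r = 0 \/ exists2 w, w \in G /\ 0 < dot a w & r = q w]
    [set q w | w in [set w | w \in G /\ dot a w < 0]].
- move=> _ _ [->|[w1 [w1G a1 ->]]] [w2 [w2G a2] <-].
    by rewrite /q mulNr oppr_ge0 mulr_ge0_le0 ?Hl0 ?invr_le0// ltW.
  rewrite /q ler_pdivrMr// mulrAC ler_ndivlMr//.
  have := Hl1 _ _ w1G w2G a1 a2; lra.
- have [b Hb] := seq_ubound (0 :: G) q; exists (Num.max 0 b) => r [->|].
    by rewrite le_max lexx.
  by case=> w' [w'G _] ->; rewrite le_max Hb ?orbT// in_cons w'G orbT.
- have [b Hb] := seq_lbound G q; exists b => _ [w' [w'G _] <-].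
  exact: Hb.
have c0 : 0 <= c by apply: cA; left.
have : 0 <= dot (l + c *: a) w.
  apply: HG => [w' w'G|b bs]; last by apply: Hw; rewrite in_cons bs orbT.
  rewrite dotDl dotZl.
  have [aw|aw|aw] := ltgtP (dot a w') 0.
  - have /cB : [set q w | w in [set w | w \in G /\ dot a w < 0]] (q w')
      by exists w'.
    by rewrite /q ler_ndivlMr//; lra.
  - have /cA : [set r | r = 0 \/ exists2 w, w \in G /\ 0 < dot a w & r = q w]
      (q w') by right; exists w'.
    by rewrite /q ler_pdivrMr//; lra.
  - by rewrite aw mulr0 addr0 Hl0// aw.
have : dot a w <= 0 by apply: Hw; rewrite mem_head.
rewrite dotDl dotZl; nra.
Qed.

Lemma dot_mulmx_tr (R : realType) (p : nat) (x w : 'rV[R]_p) (B : 'M[R]_p) :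
  dot x (w *m B^T) = dot (x *m B) w.
Proof.
have dotE (a b : 'rV[R]_p) : dot a b = (a *m b^T) 0 0.
  by rewrite mxE; apply: eq_bigr => i _; rewrite mxE.
by rewrite !dotE trmx_mul trmxK mulmxA.
Qed.

Lemma convex_comb_shift (R : pzRingType) (V : lmodType R) (t : R) (z a b : V) :
  t *: (z + a) + (1 - t) *: (z + b) = z + (t *: a + (1 - t) *: b).
Proof.
by rewrite !scalerDr addrACA -scalerDl [t + _]addrC subrK scale1r.
Qed.

Section small_reals.
Context {R : realType}.

Lemma seq_pos_lbound (T : eqType) (s : seq T) (phi : T -> R) :
  (forall z, z \in s -> 0 < phi z) ->
  exists2 e, 0 < e & forall z, z \in s -> e <= phi z.
Proof.
elim: s => [_|z s IH phi0]; first by exists 1.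
have [|e e0 He] := IH.
  by move=> x xs; apply: phi0; rewrite in_cons xs orbT.
exists (Num.min (phi z) e); first by rewrite lt_min e0 phi0 ?mem_head.
move=> x; rewrite in_cons => /predU1P[->|/He xe].
  by rewrite ge_min lexx.
by rewrite ge_min xe orbT.
Qed.

(** Replaces a limit as [t] decreases to 0, along any arbitrarily small values of [t]. *)
Lemma ge0_small_perturbation (a b : R) :
  (forall d, 0 < d -> exists2 t, 0 < t <= d & 0 <= a + t * b) -> 0 <= a.
Proof.
move=> H; rewrite leNgt; apply/negP => a0.
have b0 : 0 < `|b| + 1 by rewrite ltr_wpDl.
have [|t /andP[t0]] := H (- a / 2 / (`|b| + 1)).
  by rewrite !divr_gt0// oppr_gt0.
rewrite ler_pdivlMr// => tb ab.
have : t * b <= t * (`|b| + 1).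
  by rewrite ler_pM2l// (le_trans (ler_norm b))// lerDl.
lra.
Qed.

End small_reals.

(** * Polyhedra along rays and their tangent cones *)

Section polyhedra.
Context {R : realType} {p : nat}.
Implicit Types (P : set 'rV[R]_p) (z w : 'rV[R]_p).

Lemma polyhedron_ray P z w : polyhedron P ->
  (forall d, 0 < d -> exists2 t, 0 < t <= d & P (z + t *: w)) -> P z.
Proof.
move=> [k [a [b ->]]] H j; rewrite -subr_ge0.
apply: (@ge0_small_perturbation _ _ (- dot (a j) w)) => d /H[t t0 /(_ j)].
by rewrite dotDr dotZr => Hj; exists t => //; lra.
Qed.

(** The tangent cone at [z] is cut out by the constraints active at [z]; the inactive ones have
    slack and survive small steps. *)
Lemma polyhedron_generators P z : polyhedron P -> P z ->
  exists G : seq 'rV[R]_p,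
    (forall w, w \in G -> exists2 d, 0 < d &
       forall t, 0 < t <= d -> P (z + t *: w)) /\
    forall l, (forall w, w \in G -> 0 <= dot l w) ->
      forall w t, 0 < t -> P (z + t *: w) -> 0 <= dot l w.
Proof.
move=> [k [a [b ->]]] Pz.
have [G [G1 G2]] := cone_generators
  [seq a j | j <- [seq j <- enum 'I_k | dot (a j) z == b j]].
have active w : (forall x, x \in
    [seq a j | j <- [seq j <- enum 'I_k | dot (a j) z == b j]] ->
    dot x w <= 0) <-> forall j, dot (a j) z = b j -> dot (a j) w <= 0.
  split=> [H j jz|H x /mapP[j]].
    by apply: H; apply: map_f; rewrite mem_filter jz eqxx mem_enum.
  by rewrite mem_filter => /andP[/eqP jz _] ->; exact: H.
exists G; split => [w /G1 /active aw|l Gl w t t0 Pw].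
(* Admissible step for constraint [j]; the value 1 is a placeholder for active constraints, which
   hold along [w] for every [t > 0]. *)
- pose phi j := if dot (a j) z == b j then 1
    else (b j - dot (a j) z) / (`|dot (a j) w| + 1).
  have [j _|d d0 dphi] := @seq_pos_lbound _ _ (enum 'I_k) phi.
    rewrite /phi; case: eqP => // /eqP jz; apply: divr_gt0.
      by rewrite subr_gt0 lt_neqAle jz Pz.
    by rewrite ltr_wpDl.
  exists d => // t /andP[t0 td] j; rewrite dotDr dotZr.
  have := dphi j (mem_enum _ j); rewrite /phi; case: eqP => [jz _|jz].
    by have := aw _ jz; rewrite jz; nra.
  rewrite ler_pdivlMr ?ltr_wpDl// => H.
  have : t * dot (a j) w <= d * (`|dot (a j) w| + 1).
    have := ler_norm (dot (a j) w); have := normr_ge0 (dot (a j) w); nra.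
  lra.
- apply: G2 => //; apply/active => j jz.
  have := Pw j; rewrite dotDr dotZr jz gerDl.
  by rewrite pmulr_rle0.
Qed.

End polyhedra.

(** * Completing a subgradient of a slice to a joint subgradient *)

Section partial_subgradient.
Context {R : realType} {n m : nat}.
Variables (h : 'rV[R]_(n + m) -> \bar R) (zb : 'rV[R]_(n + m)).
Variables (c : R) (v : 'rV[R]_n).
Hypotheses (h_convex : convex_fun h) (h_gtNy : forall z, (-oo < h z)%E).
Hypotheses (hzb : h zb = c%:E).
Hypothesis v_subgradient :
  forall d, ((c + dot v d)%:E <= h (zb + row_mx d 0)%R)%E.

(** [convex_minorant] is applied to [E], essentially the epigraph of the marginal function of
    [h - c - <v, .>]. The qualification asks that each direction [u] of its domain have a negative
    multiple there. *)
Lemma partial_subgradient_relint :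
  (forall w, (h (zb + w)%R < +oo)%E -> exists (t : R) d, 0 < t /\
     (h (zb + row_mx d (- t *: rsubmx w))%R < +oo)%E) ->
  exists y, forall w, ((c + dot (row_mx v y) w)%:E <= h (zb + w)%R)%E.
Proof.
move=> cq.
pose E := [set z : 'rV[R]_m * R | exists d,
  (h (zb + row_mx d z.1)%R <= (c + dot v d + z.2)%:E)%E].
have EI w r : h (zb + w) = r%:E -> E (rsubmx w, r - c - dot v (lsubmx w)).
  move=> hw; exists (lsubmx w); rewrite /= hsubmxK hw lee_fin; lra.
have [|||y Hy] := @convex_minorant _ _ E.
- move=> [u a] [u' a'] t t01 [d Ed] [d' Ed']; exists (t *: d + (1 - t) *: d').
  move/convex_funP: h_convex => /(_ _ _ _ _ t t01 Ed Ed')/=.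
  have -> : zb + row_mx (t *: d + (1 - t) *: d') (t *: u + (1 - t) *: u') =
      t *: (zb + row_mx d u) + (1 - t) *: (zb + row_mx d' u').
    by rewrite convex_comb_shift -add_row_mx -!scale_row_mx.
  have -> : t * (c + dot v d + a) + (1 - t) * (c + dot v d' + a') =
      c + dot v (t *: d + (1 - t) *: d') + (t * a + (1 - t) * a').
    by rewrite dotDr !dotZr; ring.
  by [].
- move=> a [d /= /(le_trans (v_subgradient d))].
  by rewrite lee_fin; lra.
- move=> [u a] [d /= Ed].
  have [|t [d' [t0]]] := cq (row_mx d u).
    by apply: le_lt_trans Ed _; rewrite ltry.
  rewrite row_mxKr; set w := row_mx _ _ => hw.
  move: (h_gtNy (zb + w)) hw; case hE: (h (zb + w)) => [r| |]// _ _.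
  exists t, (r - c - dot v (lsubmx w)); split => //.
  by have := EI _ _ hE; rewrite row_mxKr.
exists y => w.
move: (h_gtNy (zb + w)); case hE: (h (zb + w)) => [r| |]// _.
  by rewrite lee_fin dot_row_mx; have /= := Hy _ (EI _ _ hE); lra.
by rewrite leey.
Qed.

(* The set C below is {(e, a) | exists d, h'(zb; (d, e)) <= <v, d> + a}, and  *)
(* y is obtained from Farkas' lemma on the generators of the tangent cones    *)
(* of the pieces.  The second-order term t^2 M allows for the quadratic part. *)
Lemma partial_subgradient_plq : piecewise_linear_quadratic h ->
  exists y, forall w, ((c + dot (row_mx v y) w)%:E <= h (zb + w)%R)%E.
Proof.
move=> [I [P [A [q [u [polyP hP hout]]]]]].
(* The gradient at [zb] is symmetrized since [A i] need not be symmetric; the expansion [taylor] is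
   then exact. *)
pose grad i := 2^-1 *: (zb *m (A i)^T + zb *m A i) + q i.
pose quad i w := 2^-1 * dot w (w *m (A i)^T).
have taylor i w t : P i zb -> P i (zb + t *: w) ->
    h (zb + t *: w) = (c + t * dot (grad i) w + t ^+ 2 * quad i w)%:E.
  move=> Pzb Pw; rewrite (hP _ _ Pw).
  have : c = 2^-1 * dot zb (zb *m (A i)^T) + dot (q i) zb - u i.
    by apply: EFin_inj; rewrite -hzb (hP _ _ Pzb).
  rewrite /grad /quad => ->; congr (_%:E).
  rewrite mulmxDl -scalemxAl !(dotDr, dotDl, dotZr, dotZl).
  rewrite (dotC w (zb *m _)) (dot_mulmx_tr zb w); ring.
pose C := [set z : 'rV[R]_m * R | exists d M, exists2 e, 0 < e &
  forall t, 0 < t <= e -> (h (zb + t *: row_mx d z.1)%R <=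
    (c + t * (dot v d + z.2) + t ^+ 2 * M)%:E)%E].
have /choice[G HG] : forall i, exists G : seq 'rV[R]_(n + m), P i zb ->
    (forall w, w \in G -> exists2 d, 0 < d &
       forall t, 0 < t <= d -> P i (zb + t *: w)) /\
    forall l, (forall w, w \in G -> 0 <= dot l w) ->
      forall w t, 0 < t -> P i (zb + t *: w) -> 0 <= dot l w.
  move=> i; have [Pi|nPi] := pselect (P i zb); last by exists [::].
  by have [G HG] := polyhedron_generators (polyP i) Pi; exists G.
pose S := [seq (rsubmx w, dot (grad i) w - dot v (lsubmx w)) |
  i <- [seq i <- enum I | `[< P i zb >]], w <- G i].
have [||||y Hy] := @cone_minorant _ _ C S.
- move=> [e a] [e' a'] [d [M [r r0 H]]] [d' [M' [r' r'0 H']]].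
  (* The sum of two directions is the midpoint of their doubles: steps of length [2 * t] halve the
     admissible range and double the second-order constant. *)
  exists (d + d'), (2 * (M + M')), (Num.min r r' / 2).
    by rewrite divr_gt0// lt_min r0.
  move=> t /andP[t0]; rewrite ler_pdivlMr// le_min => /andP[tr tr'].
  have t2 : 0 < t * 2 by rewrite mulr_gt0.
  have := H (t * 2); rewrite t2 => /(_ tr) {}H.
  have := H' (t * 2); rewrite t2 => /(_ tr') {}H'.
  have half : 0 <= (2^-1 : R) <= 1 by lra.
  move/convex_funP: h_convex => /(_ _ _ _ _ _ half H H')/=.
  have half' : (1 : R) - 2^-1 = 2^-1 by lra.
  have -> : zb + t *: row_mx (d + d') (e + e') =
      2^-1 *: (zb + (t * 2) *: row_mx d e) +
      (1 - 2^-1) *: (zb + (t * 2) *: row_mx d' e').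
    rewrite convex_comb_shift half' -add_row_mx scalerDr !scalerA mulrCA.
    by rewrite mulVf// mulr1.
  move=> /le_trans; apply; rewrite lee_fin dotDr half'.
  by rewrite le_eqVlt; apply/orP; left; apply/eqP; field.
- move=> s [e a] s0 [d [M [r r0 H]]].
  exists (s *: d), (s ^+ 2 * M), (r / s); first by rewrite divr_gt0.
  move=> t /andP[t0]; rewrite ler_pdivlMr// => ts.
  have := H (t * s); rewrite mulr_gt0//= => /(_ ts).
  rewrite -scale_row_mx scalerA => /le_trans; apply.
  by rewrite lee_fin dotZr le_eqVlt; apply/orP; left; apply/eqP; ring.
- move=> a [d [M [r r0 H]]].
  apply: (@ge0_small_perturbation _ _ M) => e e0.
  exists (Num.min r e); first by rewrite lt_min r0 e0 ge_min lexx orbT.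
  set t := Num.min r e.
  have t0 : 0 < t by rewrite lt_min r0.
  have := H t; rewrite t0 ge_min lexx => /(_ isT).
  rewrite scale_row_mx scaler0 => /(le_trans (v_subgradient _)).
  rewrite lee_fin dotZr /= => {}H.
  have : 0 <= t * (a + t * M) by lra.
  by rewrite pmulr_rge0.
- move=> _ /allpairsPdep[i [w [+ wG ->]]].
  rewrite mem_filter => /andP[/asboolP Pi _].
  have [/(_ _ wG)[d d0 Hd] _] := HG i Pi.
  exists (lsubmx w), (quad i w), d => // t td /=.
  rewrite hsubmxK (taylor i)//; last exact: Hd.
  by rewrite lee_fin [dot v _ + _]addrC subrK.
exists y => w.
move: (h_gtNy (zb + w)); case hw: (h (zb + w)) => [r| |]// _; last first.
  by rewrite leey.
have hseg (t : R) : 0 <= t <= 1 ->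
    (h (zb + t *: w)%R <= ((1 - t) * c + t * r)%:E)%E.
  move=> t01.
  have hw' : (h (zb + w)%R <= r%:E)%E by rewrite hw.
  have hzb' : (h zb <= c%:E)%E by rewrite hzb.
  move/convex_funP: h_convex => /(_ _ _ _ _ _ t01 hw' hzb').
  rewrite scalerDr addrAC -scalerDl [t + _]addrC subrK scale1r.
  by rewrite [X in (X%:E)%E]addrC.
(* By finiteness, some piece meets the segment arbitrarily close to [zb]; otherwise [h] would be
   infinite at a point of the segment, against [hseg]. *)
have [i Hi] : exists i, forall d, 0 < d ->
    exists2 t, 0 < t <= d & t <= 1 /\ P i (zb + t *: w).
  apply: contrapT => no.
  have /choice[e He] : forall i, exists e : R, 0 < e /\
      forall t, 0 < t <= e -> t <= 1 -> ~ P i (zb + t *: w).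
    move=> i; apply: contrapT => Hi; apply: no; exists i => d d0.
    apply: contrapT => Hd; apply: Hi; exists d; split => // t td t1 Pt.
    by apply: Hd; exists t.
  have [i _|d d0 Hd] := @seq_pos_lbound _ _ (enum I) e.
    exact: (He i).1.
  set t := Num.min 1 d.
  have t0 : 0 < t by rewrite lt_min ltr01 d0.
  have t1 : t <= 1 by rewrite ge_min lexx.
  have := hseg t; rewrite (ltW t0) => /(_ t1).
  rewrite hout => [|[i _ Pi]]; first by rewrite leNgt ltry.
  apply: (He i).2 Pi => //; rewrite t0/= (@le_trans _ _ d) ?Hd ?mem_enum//.
  by rewrite ge_min lexx orbT.
have Pi : P i zb.
  by apply: (@polyhedron_ray _ _ _ _ w (polyP i)) => d /Hi[t td [_ Pt]]; exists t.
have : 0 <= dot (grad i - row_mx v y) w.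
  have [t /andP[t0 _] [_ Pt]] := Hi 1 ltr01.
  apply: ((HG i Pi).2 _ _ w t t0 Pt) => g gG.
  rewrite dotBl dot_row_mx subr_ge0 addrC -lerBrDr.
  apply: (Hy (rsubmx g, dot (grad i) g - dot v (lsubmx g))).
  apply/allpairsPdep; exists i, g; split => //.
  by rewrite mem_filter mem_enum andbT; exact/asboolP.
rewrite dotBl subr_ge0 => Hle.
rewrite lee_fin -lerBrDl (le_trans Hle)// -subr_ge0.
(* Convexity bounds the difference quotient by [r - c]; the quadratic remainder vanishes as [t]
   tends to 0. *)
apply: (@ge0_small_perturbation _ _ (- quad i w)) => d.
move=> /Hi[t /andP[t0 td] [t1 Pt]].
exists t; first by rewrite t0.
have := hseg t; rewrite (ltW t0) t1 => /(_ isT).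
rewrite (taylor i)// lee_fin => H.
have : 0 <= t * (r - c - dot (grad i) w + t * - quad i w) by lra.
by rewrite pmulr_rge0.
Qed.

End partial_subgradient.

(** The line through 0 and [u] lies in the affine hull of [C], so its points near 0 belong to
    [C]. *)
Lemma rint_absorbing (R : realType) (p : nat) (C : set 'rV[R]_p) (u : 'rV[R]_p) :
  rint C 0 -> C u -> exists2 t : R, 0 < t & C (- t *: u).
Proof.
move=> [C0 /nbhs_norm0P[e /= e0 He]] Cu.
pose t := e / 2 / (`|u| + 1).
have t0 : 0 < t by rewrite !divr_gt0// ltr_wpDl.
exists t => //; apply: He => /=.
  rewrite normrZ normrN gtr0_norm// /t mulrAC ltr_pdivrMr ?ltr_wpDl//.
  have := normr_ge0 u; nra.
move=> A [Aaff CA].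
have := Aaff 0 u (- t) (C0 _ (conj Aaff CA)) (CA _ Cu).
by rewrite scaler0 add0r.
Qed.

(** * Convexity and subdifferentials of the composite *)

Section composite_subdifferential.
Context {R : realType} {n m : nat}.
Variables (f0 : 'rV[R]_n -> \bar R) (F : 'rV[R]_n -> option 'rV[R]_m).
Variable g : 'rV[R]_m -> \bar R.
Hypothesis f_Gamma : Gamma (joint (perturbation f0 F g)).

Let h := joint (perturbation f0 F g).
Let h_gtNy : forall z, (-oo < h z)%E := f_Gamma.1.2.
Let h_convex : convex_fun h := f_Gamma.2.

Lemma joint_row_mx (x : 'rV[R]_n) (u : 'rV[R]_m) (w : 'rV[R]_m) :
  F x = Some w -> h (row_mx x u) = (f0 x + g (w + u)%R)%dE.
Proof. by move=> Fx; rewrite /h /joint row_mxKl row_mxKr /perturbation Fx. Qed.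

Lemma joint_ltyP (x : 'rV[R]_n) (u : 'rV[R]_m) :
  (h (row_mx x u) < +oo)%E -> exists w, F x = Some w.
Proof.
by rewrite /h /joint row_mxKl /perturbation; case: (F x) => // w _; exists w.
Qed.

(** Properness of [f] provides finite values of [f0] and [g]; fixing one of them transfers
    properties of [f] to the other function. *)
Lemma exists_finite_value : exists x w w' (r s : R),
  [/\ F x = Some w, f0 x = r%:E & g w' = s%:E].
Proof.
have [[z hz] /(_ z)] := f_Gamma.1.
move: hz; rewrite -[z]hsubmxK /joint !(row_mxKl, row_mxKr) /perturbation.
case Fx: (F (lsubmx z)) => [w|]//.
case fx: (f0 (lsubmx z)) => [r| |]; case gx: (g (w + rsubmx z)) => [s| |]// _ _.
by exists (lsubmx z), w, (w + rsubmx z), r, s.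
Qed.

Lemma outer_gtNy w : (-oo < g w)%E.
Proof.
have [x [w' [_ [r [_ [Fx fx _]]]]]] := exists_finite_value.
have := h_gtNy (row_mx x (w - w')).
rewrite (joint_row_mx _ Fx) [w' + _]addrC subrK fx.
by case: (g w) => [s| |]//; rewrite ?ltNyr ?ltNyy.
Qed.

Lemma inner_gtNy x w : F x = Some w -> (-oo < f0 x)%E.
Proof.
move=> Fx; have [_ [_ [w' [_ [s [_ _ gw']]]]]] := exists_finite_value.
have := h_gtNy (row_mx x (w' - w)).
rewrite (joint_row_mx _ Fx) [w + _]addrC subrK gw'.
by case: (f0 x) => [r| |]//; rewrite ?ltNyr ?ltNyy.
Qed.

Lemma inner_finite x w (a : \bar R) (b : R) :
  F x = Some w -> (f0 x + a <= b%:E)%dE -> exists r, f0 x = r%:E.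
Proof.
move=> /inner_gtNy; case: (f0 x) => [r| |]//; by exists r.
Qed.

Lemma composite_convex : convex_fun (composite f0 F g).
Proof.
have compE x : composite f0 F g x = h (row_mx x 0).
  rewrite /h /joint row_mxKl row_mxKr /composite /perturbation.
  by case: (F x) => // w; rewrite addr0.
apply/convex_funP => x x' a b t t01; rewrite !compE => hx hx'.
move/convex_funP: h_convex => /(_ _ _ _ _ _ t01 hx hx').
by rewrite !scale_row_mx add_row_mx !scaler0 addr0.
Qed.

Lemma outer_convex : convex_fun g.
Proof.
have [x [w [_ [r [_ [Fx fx _]]]]]] := exists_finite_value.
apply/convex_funP => w1 w2 a b t t01 g1 g2.
have hE w' : h (row_mx x 0 + row_mx 0 (w' - w)) = (r%:E + g w')%dE.
  by rewrite add_row_mx addr0 add0r (joint_row_mx _ Fx) fx [w + _]addrC subrK.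
have hle w' d : (g w' <= d%:E)%E ->
    (h (row_mx x 0 + row_mx 0 (w' - w)) <= (r + d)%:E)%E.
  rewrite hE; move: (outer_gtNy w'); case: (g w') => [s| |]// _.
  by rewrite !lee_fin lerD2l.
move/convex_funP: h_convex => /(_ _ _ _ _ _ t01 (hle _ _ g1) (hle _ _ g2)).
rewrite convex_comb_shift !scale_row_mx add_row_mx !scaler0 addr0.
have -> : t *: (w1 - w) + (1 - t) *: (w2 - w) =
    (t *: w1 + (1 - t) *: w2) - w.
  by rewrite ![_ - w]addrC convex_comb_shift.
rewrite hE; move: (outer_gtNy (t *: w1 + (1 - t) *: w2)).
by case: (g _) => [s| |]// _; rewrite !lee_fin; lra.
Qed.

(* Up to the constant g^*(y), the Lagrangian is the marginal function         *)
(* inf_u (f(x, u) - <y, u>), hence inherits convexity from f.                 *)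
Lemma lagrangian_convex y :
  edom (conjugate g) y -> convex_fun (lagrangian f0 F y).
Proof.
move=> ydom.
have [_ [_ [w1 [_ [s1 [_ _ gw1]]]]]] := exists_finite_value.
have conj_ge w : ((dot y w)%:E - g w <= conjugate g y)%E.
  by apply: ereal_sup_ubound; exists w.
have [s conjE] : exists s, conjugate g y = s%:E.
  move: ydom (conj_ge w1); rewrite /edom /= gw1.
  by case: (conjugate g y) => [s| |]// _ _; exists s.
have g_ge w : ((dot y w - s)%:E <= g w)%E.
  move: (conj_ge w) (outer_gtNy w); rewrite conjE.
  by case: (g w) => [r| |]//; rewrite ?lee_fin ?leey//; lra.
apply/convex_funP => x x' a b t t01.
rewrite /lagrangian /scalarization.
case Fx: (F x) => [w|]; last by case: (f0 x).
case Fx': (F x') => [w'|]; last by move=> _; case: (f0 x').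
move=> La Lb.
have [r fx] := inner_finite Fx La; have [r' fx'] := inner_finite Fx' Lb.
move: La Lb; rewrite fx fx' !lee_fin => La Lb.
apply/lee_addgt0Pr => e e0; rewrite -EFinD.
(* A near-maximizer of the conjugate at [y]. Using the same [w0] at both points makes the dependence
   on [w] and [w'] linear. *)
have [w0 [s0 [gw0 s0e]]] : exists w0 s0, g w0 = s0%:E /\ s0 <= dot y w0 - s + e.
  have : ((s - e)%:E < conjugate g y)%E by rewrite conjE lte_fin; lra.
  move=> /ereal_sup_gt[_ [w0 _ <-]]; move: (outer_gtNy w0).
  case gw0: (g w0) => [s0| |]// _; rewrite lte_fin => H.
  by exists w0, s0; split => //; lra.
have hx : (h (row_mx x (w0 - w)) <= (r + s0)%:E)%E.
  by rewrite (joint_row_mx _ Fx) [w + _]addrC subrK fx gw0.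
have hx' : (h (row_mx x' (w0 - w')) <= (r' + s0)%:E)%E.
  by rewrite (joint_row_mx _ Fx') [w' + _]addrC subrK fx' gw0.
move/convex_funP: h_convex => /(_ _ _ _ _ _ t01 hx hx').
rewrite !scale_row_mx add_row_mx convex_comb_shift => hc.
(* Finiteness of [f] at the combination places it in the domain of [F]. *)
have [|w2 Fx2] := @joint_ltyP (t *: x + (1 - t) *: x')
    (w0 + (t *: - w + (1 - t) *: - w')).
  by apply: le_lt_trans hc _; rewrite ltry.
move: hc; rewrite (joint_row_mx _ Fx2) Fx2 => hc.
have [r2 fx2] := inner_finite Fx2 hc.
move: hc (g_ge (w2 + (w0 + (t *: - w + (1 - t) *: - w')))); rewrite fx2.
case: (g _) => [s2| |]//; rewrite !lee_fin !dotDr !dotZr !dotNr.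
move: t01 => /andP[t0 t1]; nra.
Qed.

Lemma composite_subdiff_sup (xb : 'rV[R]_n) (wb y : 'rV[R]_m) :
  F xb = Some wb -> subdiff g wb y ->
  subdiff (lagrangian f0 F y) xb `<=` subdiff (composite f0 F g) xb.
Proof.
move=> Fxb [gfin gy] v [Lfin Lv].
move: Lfin Lv; rewrite /subdiff/= /lagrangian /composite /scalarization Fxb.
move: gfin gy; case gwb: (g wb) => [s| |]// _ gy.
case fxb: (f0 xb) => [r| |]// _ Lv.
split => // x; move: (Lv x).
case Fx: (F x) => [w|]; last by rewrite leey.
move: (gy w) (outer_gtNy w) (inner_gtNy Fx).
case: (g w) => [s'| |]//; case: (f0 x) => [r'| |]//; rewrite ?leey//.
by rewrite !lee_fin !dotBr => ? _ _ ?; lra.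
Qed.

Lemma composite_subdiff_sub (xb v : 'rV[R]_n) (wb : 'rV[R]_m) :
  rint (shift_set f0 F g) 0 \/ piecewise_linear_quadratic h ->
  F xb = Some wb -> subdiff (composite f0 F g) xb v ->
  exists2 y, subdiff g wb y & subdiff (lagrangian f0 F y) xb v.
Proof.
move=> cq Fxb [cfin cv].
move: cfin cv; rewrite /composite Fxb.
case fxb: (f0 xb) => [r| |]; case gwb: (g wb) => [s| |]// _ cv.
have hzb : h (row_mx xb 0) = (r + s)%:E.
  by rewrite (joint_row_mx _ Fxb) addr0 fxb gwb.
have hv d : ((r + s + dot v d)%:E <= h (row_mx xb 0 + row_mx d 0)%R)%E.
  rewrite add_row_mx addr0; have := cv (xb + d).
  rewrite [xb + d]addrC addrK /h /joint row_mxKl row_mxKr /perturbation.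
  by case: (F _) => [w|]//; rewrite addr0.
have [y Hy] : exists y, forall w,
    ((r + s + dot (row_mx v y) w)%:E <= h (row_mx xb 0 + w)%R)%E.
  case: cq => [rint0|plq]; last first.
    exact: (partial_subgradient_plq h_convex h_gtNy hzb hv plq).
  apply: (partial_subgradient_relint h_convex h_gtNy hv).
  have UE u : shift_set f0 F g u <-> exists x, (h (row_mx x u) < +oo)%E.
    rewrite shift_setE /=; split => [/ereal_inf_lt[_ [x _ <-] hx]|[x hx]].
      by exists x; rewrite /h /joint row_mxKl row_mxKr.
    apply: le_lt_trans hx; apply: ereal_inf_lbound; exists x => //.
    by rewrite /h /joint row_mxKl row_mxKr.
  move=> w hw.
  (* [U] is the projection of the domain of [f], so absorption yields the opposite direction. *)
  have /(rint_absorbing rint0)[t t0 /UE[x hx]] : shift_set f0 F g (rsubmx w).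
    apply/UE; exists (xb + lsubmx w).
    by move: hw; rewrite -{1}[w]hsubmxK add_row_mx add0r.
  exists t, (x - xb); split => //.
  by rewrite add_row_mx add0r [xb + _]addrC subrK.
(* The change of variable [u = w' - w] makes [w'] the argument of [g]. *)
have {}Hy x w w' : F x = Some w ->
    ((r + s + dot v (x - xb) + dot y (w' - w))%:E <= f0 x + g w')%dE.
  move=> Fx; have := Hy (row_mx (x - xb) (w' - w)).
  rewrite add_row_mx add0r dot_row_mx row_mxKl row_mxKr addrA.
  by rewrite [xb + _]addrC subrK (joint_row_mx _ Fx) [w + _]addrC subrK.
exists y; split.
- by rewrite gwb.
- move=> w; rewrite gwb; have := Hy xb wb w Fxb; rewrite fxb subrr dot0r addr0.
  by case: (g w) => [s'| |]//; rewrite ?leey// !lee_fin; lra.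
- by rewrite /lagrangian /scalarization Fxb fxb.
- move=> x; rewrite /lagrangian /scalarization Fxb fxb.
  case Fx: (F x) => [w|]; last by case: (f0 x) => *; rewrite leey.
  have := Hy x w wb Fx; rewrite gwb.
  by case: (f0 x) => [r'| |]//; rewrite ?leey// !lee_fin !dotBr; lra.
Qed.

End composite_subdifferential.

Theorem corollary3p1 (R : realType) (n m : nat)
    (f0 : 'rV[R]_n -> \bar R) (F : 'rV[R]_n -> option 'rV[R]_m)
    (g : 'rV[R]_m -> \bar R)
    (f_Gamma : Gamma (joint (perturbation f0 F g)))
    (f_closed : forall x : 'rV[R]_n, closed_fun (perturbation f0 F g x))
    (F_dom : odom F !=set0) :
  [/\ convex_fun (composite f0 F g),
      convex_fun g,
      forall yb : 'rV[R]_m, edom (conjugate g) yb ->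
        convex_fun (lagrangian f0 F yb),
      forall (xb : 'rV[R]_n) (wb : 'rV[R]_m),
        edom (composite f0 F g) xb -> F xb = Some wb ->
        \bigcup_(yb in subdiff g wb) subdiff (lagrangian f0 F yb) xb
          `<=` subdiff (composite f0 F g) xb
    & Gamma0 (joint (perturbation f0 F g)) ->
      rint (shift_set f0 F g) 0 \/
        (shift_set f0 F g 0 /\
         piecewise_linear_quadratic (joint (perturbation f0 F g))) ->
      forall (xb : 'rV[R]_n) (wb : 'rV[R]_m),
        edom (composite f0 F g) xb -> F xb = Some wb ->
        subdiff (composite f0 F g) xb =
        \bigcup_(yb in subdiff g wb) subdiff (lagrangian f0 F yb) xb].
Proof.
split=> [|||xb wb _ Fxb v [y gy Ly]|_ cq xb wb _ Fxb].
- exact: composite_convex f_Gamma.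
- exact: outer_convex f_Gamma.
- by move=> y; exact: lagrangian_convex.
- exact: (composite_subdiff_sup f_Gamma Fxb gy).
apply/seteqP; split=> [v cv|v [y gy Ly]]; last first.
  exact: (composite_subdiff_sup f_Gamma Fxb gy).
have [|y gy Ly] := composite_subdiff_sub f_Gamma _ Fxb cv; last by exists y.
by case: cq => [|[_]]; [left|right].
Qed.
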